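(* Let $K$ be a field of characteristic different from $2$, and let $\varphi$ and $\psi$ be anisotropic quadratic forms over $K$ of dimensions $\geq 2$. The following are equivalent: (1) $\varphi\sim_{stb}\psi$ over $K$; (2) for every field extension $F/K$, $D_F(\psi)D_F(\psi)=D_F(\varphi)D_F(\varphi)$; (3) for every $n\geq1$, $\langle\langle X_1,\ldots,X_n\rangle\rangle\otimes\varphi\sim_{stb}\langle\langle X_1,\ldots,X_n\rangle\rangle\otimes\psi$ over $K(X_1,\ldots,X_n)$, where $X_1,\ldots,X_n$ are algebraically independent variables; (4) for every field extension $F/K$, every $n\geq1$ and every $\tau\in GP_n(F)$, $\varphi\otimes\tau\sim_{stb}\psi\otimes\tau$ over $F$.
   Context: Quadratic forms are finite-dimensional and nondegenerate; isotropic means representing $0$ nontrivially. $D_F(\varphi)$ is the set of nonzero elements of $F$ represented by $\varphi_F$, and $D_F(\varphi)D_F(\varphi)=\{ab:a,b\in D_F(\varphi)\}$. The function field of a form $\psi\simeq\langle b_1,\ldots,b_m\rangle$ over a field $L$ with $m\geq 2$ is $L(\psi)=L(Y_2,\ldots,Y_m)\bigl(\sqrt{-\tfrac{1}{b_1}(b_2Y_2^2+\cdots+b_mY_m^2)}\bigr)$. Forms $\varphi,\psi$ over $L$ are stably birationally equivalent, $\varphi\sim_{stb}\psi$, if $\varphi_{L(\psi)}$ and $\psi_{L(\varphi)}$ are both isotropic. $\langle\langle a_1,\ldots,a_n\rangle\rangle=\langle1,-a_1\rangle\otimes\cdots\otimes\langle1,-a_n\rangle$ is an $n$-fold Pfister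 form, and $GP_n(F)$ is the set of forms over $F$ similar to an $n$-fold Pfister form. *)

(* Defs.v *)
From HB Require Import structures.
From mathcomp Require Import all_boot all_order all_algebra all_field.
From mathcomp Require Import mxtens boolp.
From mathcomp Require Import mpoly.

Set Implicit Arguments.
Unset Strict Implicit.
Unset Printing Implicit Defensive.

Import GRing.Theory.
Local Open Scope ring_scope.

(* A quadratic form over a field of characteristic not 2, given by the         *)
(* symmetric Gram matrix A of its polar form: v |-> v A v^T on K^n.            *)
Record qform (K : fieldType) := QForm {
  qdim : nat;
  qmx : 'M[K]_qdim;
  qmx_sym : qmx^T == qmx
}.

Section QuadraticForms.
Variable K : fieldType.
Implicit Types (q r : qform K) (s : seq K) (a c : K).

Definition qval q (v : 'rV[K]_(qdim q)) : K := (v *m qmx q *m v^T) 0 0.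

Definition qnondegenerate q : bool := qmx q \in unitmx.

Definition qisotropic q : Prop := exists v, v != 0 /\ qval (q := q) v = 0.

Definition qanisotropic q : Prop := ~ qisotropic q.

Definition qrepresents q a : Prop := a != 0 /\ exists v, qval (q := q) v = a.

Definition qrepresents_mul q c : Prop :=
  exists a b, [/\ qrepresents q a, qrepresents q b & c = a * b].

Definition qisometric q r : Prop :=
  exists P : 'M[K]_(qdim q, qdim r),
    [/\ row_free P, row_full P & qmx q = P *m qmx r *m P^T].

Fact qdiag_sym s : let A := diag_mx (\row_(i < size s) s`_i) in A^T == A.
Proof. by rewrite /= tr_diag_mx. Qed.

Definition qdiag s : qform K := QForm (qdiag_sym s).

Fact qtensor_sym q r : (qmx q *t qmx r)^T == qmx q *t qmx r.
Proof. by rewrite trmx_tens (eqP (qmx_sym q)) (eqP (qmx_sym r)). Qed.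

Definition qtensor q r : qform K := QForm (qtensor_sym q r).

Fact qscale_sym c q : (c *: qmx q)^T == c *: qmx q.
Proof. by rewrite linearZ /= (eqP (qmx_sym q)). Qed.

Definition qscale c q : qform K := QForm (qscale_sym c q).

Definition pfister s : qform K :=
  foldr (fun a q => qtensor (qdiag [:: 1; - a]) q) (qdiag [:: 1]) s.

Definition general_pfister (n : nat) q : Prop :=
  exists c s, [/\ c != 0, size s = n, all (fun a => a != 0) s
                & qisometric q (qscale c (pfister s))].

End QuadraticForms.

Section BaseChange.
Variables (K F : fieldType) (f : {rmorphism K -> F}) (q : qform K).

Fact qbase_sym : (map_mx f (qmx q))^T == map_mx f (qmx q).
Proof. by rewrite map_trmx (eqP (qmx_sym q)). Qed.

Definition qbase : qform F := QForm qbase_sym.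

End BaseChange.

(* E(sqrt d), as E[T]/(p) for a monic irreducible factor p of T^2 - d: this is *)
(* a quadratic extension if d is not a square in E, and a copy of E if it is.  *)
Section SquareRoot.
Variables (E : fieldType) (d : E).

Fact sqrt_poly_subproof :
  exists p : {poly E}, monic_irreducible_poly p /\ p %| 'X^2 - d%:P.
Proof.
have sz : size ('X^2 - d%:P) = 3 by rewrite size_XnsubC.
have mon : 'X^2 - d%:P \is monic by rewrite monicXnsubC.
case: (pselect (exists r, root ('X^2 - d%:P) r)) => [[r rP]|nr].
  exists ('X - r%:P); split; last by rewrite dvdp_XsubCl.
  split; last exact: monicXsubC.
  by apply: irredp_XsubC.
exists ('X^2 - d%:P); split=> //; split=> //.
apply: cubic_irreducible; first by rewrite sz.
by move=> r; apply/negP => rr; apply: nr; exists r.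
Qed.

Definition sqrt_poly : {poly E} := sval (cid sqrt_poly_subproof).

Fact sqrt_poly_irr : monic_irreducible_poly sqrt_poly.
Proof. by case: (svalP (cid sqrt_poly_subproof)). Qed.

Fact sqrt_poly_dvd : sqrt_poly %| 'X^2 - d%:P.
Proof. by case: (svalP (cid sqrt_poly_subproof)). Qed.

Definition sqrt_ext : fieldType := {poly %/ sqrt_poly with sqrt_poly_irr}.

Definition sqrt_emb : {rmorphism E -> sqrt_ext} := qpolyC sqrt_poly.

End SquareRoot.

Definition ratfun (L : fieldType) (n : nat) : fieldType :=
  {fraction {mpoly L[n]}}.

Definition ratfun_const (L : fieldType) (n : nat) : {rmorphism L -> ratfun L n} :=
  @tofrac {mpoly L[n]} \o @mpolyC n L.

Definition ratfun_var (L : fieldType) (n : nat) (i : 'I_n) : ratfun L n :=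
  @tofrac {mpoly L[n]} 'X_i.

(* The function field of <b_0, ..., b_k>, for b = [:: b_0; ...; b_k] with      *)
(* k >= 1; the variable of index i : 'I_k goes with the coefficient b_(i+1).   *)
Section FunctionField.
Variables (L : fieldType) (b : seq L).
Let E := ratfun L (size b).-1.
Let cst := @ratfun_const L (size b).-1.

Definition ff_radicand : E :=
  - (cst b`_0)^-1 *
    \sum_(i < (size b).-1) cst b`_i.+1 * ratfun_var L i ^+ 2.

Definition function_field : fieldType := sqrt_ext ff_radicand.

Definition ff_emb : {rmorphism L -> function_field} :=
  sqrt_emb ff_radicand \o cst.

End FunctionField.

(* Two diagonalizations of psi yield L-isomorphic function fields, so any one  *)
(* may be used to express that phi is isotropic over L(psi).                   *)
Definition qisotropic_over_ff (L : fieldType) (phi psi : qform L) : Prop :=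
  exists b : seq L,
    qisometric psi (qdiag b) /\ qisotropic (qbase (ff_emb b) phi).

Definition stb (L : fieldType) (phi psi : qform L) : Prop :=
  qisotropic_over_ff phi psi /\ qisotropic_over_ff psi phi.

Definition generic_pfister (K : fieldType) (n : nat) : qform (ratfun K n) :=
  pfister [seq ratfun_var K i | i <- enum 'I_n].

(* Main.v *)
(* Call phi and psi iso-equivalent if over every extension F of K one is      *)
(* isotropic exactly when the other is.  All four conditions are equivalent   *)
(* to this.                                                                   *)
(* - For (1): an isotropic vector of phi over K(psi) is a pair of polynomial  *)
(*   vectors g, h with phi(g) + D phi(h) = 0 and g orthogonal to h.  If psi   *)
(*   has an isotropic vector w over F with w_0 != 0, substitute w_i + t S_i   *)
(*   for the variables, remove the powers of t and set t = 0; as D becomes    *)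
(*   w_0^2, one of g + w_0 h, g - w_0 h is a nonzero isotropic vector of phi  *)
(*   over F[S], and its leading coefficients are isotropic over F.            *)
(* - For (2): c lies in D_F(q) D_F(q) iff <<c>> q is isotropic.  Passing from *)
(*   q to <<c>> q preserves iso-equivalence because the isotropy of <<c>> q   *)
(*   is governed by the isotropy of q over quadratic extensions of F.         *)
(* - Iterating <<c>> gives (3) and (4).  Conversely, for t transcendental     *)
(*   over F, <<t>> q is isotropic over F(t) only if q is isotropic over F,    *)
(*   by parity of degrees.                                                    *)

Require Import Defs.
From HB Require Import structures.
From mathcomp Require Import all_boot all_order all_algebra.
From mathcomp Require Import ring mxtens boolp qpoly qfpoly mpoly.

Set Implicit Arguments.
Unset Strict Implicit.
Unset Printing Implicit Defensive.

Import Order.Theory GRing.Theory.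
Local Open Scope ring_scope.

(** * Symmetric bilinear forms given by matrices *)

(** Every condition is compared with [iso_equiv]. The function field K(psi) is a generic extension
    making psi isotropic: psi is isotropic over it ([ff_self_iso]), and a form isotropic over it is
    isotropic over every F over which psi is ([ff_iso_specialize]). This gives [stbP], which turns
    [stb] into [iso_equiv] for phi and psi as well as for their Pfister multiples.

    The rest concerns the forms <<c>> phi. For c nonzero, <<c>> phi is isotropic exactly when c is a
    product of two values of phi ([represents_mulP]). An isotropic vector of <<c>> phi yields one of
    phi over F or over some F(sqrt d), unless c is a square; the equivalence moves it to psi, and it
    descends to <<c>> psi over F ([binary_tens_step]). Iteration gives all Pfister multiples
    ([iso_equiv_pfister]).

    The way back uses a variable t: <<t>> phi is isotropic over F(t) exactly when phi is isotropic
    over F ([generic_tens_iso]). So (2), (3) and (4), taken at c = t or at <<t>>, each recover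
    [iso_equiv]. *)

Section BilinearForm.
Variables (R : comNzRingType) (n : nat).
Implicit Types (A : 'M[R]_n) (u v w : 'rV[R]_n) (a : R).

(** Coefficients lie in a commutative ring, so that vectors with polynomial entries are covered once
    denominators are cleared. Over a field, [bil (qmx q) v v] and [mxiso (qmx q)] are convertible to
    [qval v] and [qisotropic q]. *)
Definition bil A u v : R := (u *m A *m v^T) 0 0.

Definition mxiso A : Prop := exists v, v != 0 /\ bil A v v = 0.

Lemma bilDl A u v w : bil A (u + v) w = bil A u w + bil A v w.
Proof. by rewrite /bil !mulmxDl mxE. Qed.

Lemma bilDr A u v w : bil A u (v + w) = bil A u v + bil A u w.
Proof. by rewrite /bil linearD /= mulmxDr mxE. Qed.

Lemma bilZl A a u v : bil A (a *: u) v = a * bil A u v.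
Proof. by rewrite /bil -!scalemxAl mxE. Qed.

Lemma bilZr A a u v : bil A u (a *: v) = a * bil A u v.
Proof. by rewrite /bil linearZ /= -scalemxAr mxE. Qed.

Lemma bilC A u v : A^T = A -> bil A u v = bil A v u.
Proof.
move=> sA; rewrite /bil -[in LHS](trmxK (u *m A *m v^T)) [in LHS]mxE.
by rewrite !trmx_mul trmxK sA mulmxA.
Qed.

Lemma bil0 A v : bil A 0 v = 0.
Proof. by rewrite /bil !mul0mx mxE. Qed.

Lemma bilE A u v : bil A u v = \sum_i \sum_j u 0 i * A i j * v 0 j.
Proof.
rewrite /bil mxE exchange_big; apply: eq_bigr => j _ /=.
by rewrite !mxE mulr_suml.
Qed.

Lemma bil_quadD A u v a b : A^T = A ->
  bil A (a *: u + b *: v) (a *: u + b *: v) =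
  a ^+ 2 * bil A u u + (a * b * bil A u v) *+ 2 + b ^+ 2 * bil A v v.
Proof.
by move=> sA; rewrite !(bilDl, bilDr, bilZl, bilZr) (bilC v u sA); ring.
Qed.

End BilinearForm.

Lemma bil_map (R S : comNzRingType) (h : {rmorphism R -> S}) n (A : 'M[R]_n) u v :
  bil (map_mx h A) (map_mx h u) (map_mx h v) = h (bil A u v).
Proof. by rewrite /bil map_trmx -!map_mxM mxE. Qed.

Lemma row_neq0P (R : nmodType) n (v : 'rV[R]_n) :
  reflect (exists i, v 0 i != 0) (v != 0).
Proof.
apply: (iffP idP) => [nv|[i vi]].
  apply/existsP; apply: contraR nv => /existsPn h.
  by apply/eqP/rowP => i; rewrite mxE; apply/eqP; rewrite -[_ == _]negbK h.
by apply: contraNneq vi => ->; rewrite mxE.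
Qed.

Lemma map_row_eq0 (R S : nzRingType) (h : {rmorphism R -> S}) n (v : 'rV[R]_n) :
  injective h -> (map_mx h v == 0) = (v == 0).
Proof.
move=> ih; apply/eqP/eqP => [hv|->]; last by rewrite map_mx0.
apply/rowP => i; move/rowP/(_ i): hv; rewrite !mxE => /eqP.
by rewrite (raddf_eq0 _ ih) => /eqP.
Qed.

Lemma qmxT (K : fieldType) (q : qform K) : (qmx q)^T = qmx q.
Proof. exact/eqP/qmx_sym. Qed.

Lemma map_qmxT (K : fieldType) (R : nzRingType) (f : {rmorphism K -> R}) (q : qform K) :
  (map_mx f (qmx q))^T = map_mx f (qmx q).
Proof. by rewrite map_trmx qmxT. Qed.

(** * Fraction fields *)

Section Fractions.
Variable R : idomainType.

Lemma fractionP (x : {fraction R}) :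
  exists a b : R, b != 0 /\ x = tofrac a / tofrac b.
Proof.
elim/quotW: x => -[[a b] /= b0]; exists a, b; split=> //.
have fb : tofrac b != 0 by rewrite tofrac_eq0.
apply: (mulIf fb); rewrite divfK //; unlock FracField.tofrac.
rewrite piE; apply/eqmodP; rewrite /= FracField.equivfE /= /FracField.mulf.
by rewrite !numden_Ratio ?oner_eq0 ?mulf_neq0 ?oner_eq0 //= !mulr1 mulrC.
Qed.

(** The product of the denominators of all entries serves as a common denominator. *)
Lemma frac_row n (v : 'rV[{fraction R}]_n) :
  exists (c : R) (u : 'rV[R]_n), c != 0 /\ tofrac c *: v = map_mx (@tofrac R) u.
Proof.
have [a /choice [b ab]] := choice (fun i : 'I_n => fractionP (v 0 i)).
exists (\prod_i b i), (\row_i (a i * \prod_(j | j != i) b j)); split.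
  by apply/prodf_neq0 => i _; case: (ab i).
apply/rowP => i; case: (ab i) => bi e; rewrite !mxE e (bigD1 i) //= !rmorphM /=.
by have := bi; rewrite -tofrac_eq0 => fb; field.
Qed.

Variables (L : fieldType) (h : {rmorphism R -> L}).
Hypothesis h_inj : injective h.

Let num x := sval (cid (fractionP x)).
Let den x := sval (cid (svalP (cid (fractionP x)))).
Let den_neq0 x : den x != 0.
Proof. by case: (svalP (cid (svalP (cid (fractionP x))))). Qed.
Let num_den x : x = tofrac (num x) / tofrac (den x).
Proof. by case: (svalP (cid (svalP (cid (fractionP x))))). Qed.

(** The universal property of the fraction field. Numerator and denominator are chosen; [frac_liftE]
    shows that the choice does not matter. *)
Definition frac_lift (x : {fraction R}) : L := h (num x) / h (den x).

Lemma frac_liftE a b : b != 0 -> frac_lift (tofrac a / tofrac b) = h a / h b.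
Proof.
move=> b0; set x := _ / _; rewrite /frac_lift.
have hd := den_neq0 x.
have := num_den x; rewrite {1}/x => /eqP.
rewrite eqr_div ?tofrac_eq0 // -!rmorphM tofrac_eq => /eqP e.
apply/eqP; rewrite eqr_div ?(raddf_eq0 _ h_inj) // -!rmorphM.
by rewrite e.
Qed.

Lemma frac_lift_zmod_morphism : zmod_morphism frac_lift.
Proof.
move=> x y; have [a [b [b0 ->]]] := fractionP x; have [c [d [d0 ->]]] := fractionP y.
have [fb fd] : tofrac b != 0 /\ tofrac d != 0 by rewrite !tofrac_eq0.
rewrite -mulNr addf_div // -rmorphN -!rmorphM -rmorphD !frac_liftE ?mulf_neq0 //.
rewrite !(rmorphM, rmorphD, rmorphN) /= -mulNr addf_div ?(raddf_eq0 _ h_inj) //.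
Qed.

Lemma frac_lift_monoid_morphism : monoid_morphism frac_lift.
Proof.
split=> [|x y].
  have -> : 1 = tofrac 1 / tofrac 1 :> {fraction R} by rewrite rmorph1 divr1.
  by rewrite frac_liftE ?oner_eq0 // rmorph1 divr1.
have [a [b [b0 ->]]] := fractionP x; have [c [d [d0 ->]]] := fractionP y.
by rewrite mulf_div -!rmorphM !frac_liftE ?mulf_neq0 // !rmorphM mulf_div.
Qed.

Lemma frac_extend :
  exists g : {rmorphism {fraction R} -> L}, forall a, g (tofrac a) = h a.
Proof.
pose am := GRing.isZmodMorphism.Build _ _ _ frac_lift_zmod_morphism.
pose mm := GRing.isMonoidMorphism.Build _ _ _ frac_lift_monoid_morphism.
pose g : {rmorphism {fraction R} -> L} := HB.pack frac_lift am mm.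
exists g => a; rewrite -[tofrac a]divr1 -(rmorph1 (@tofrac R)) /=.
by rewrite frac_liftE ?oner_eq0 // rmorph1 divr1.
Qed.

End Fractions.

(** * Quadratic extensions *)

Section SqrtExtension.
Variables (E : fieldType) (d : E).
Local Notation p := (sqrt_poly d).
Local Notation emb := (sqrt_emb d).

Definition sqrt_gen : sqrt_ext d := in_qpoly p 'X.

Lemma mk_monic_sqrt_poly : mk_monic p = p.
Proof. exact: mk_monicE (sqrt_poly_irr d). Qed.

Lemma size_sqrt_poly_le3 : (size p <= 3)%N.
Proof.
have nz : 'X^2 - d%:P != 0 :> {poly E} by rewrite -size_poly_eq0 size_XnsubC.
by apply: leq_trans (dvdp_leq nz (sqrt_poly_dvd d)) _; rewrite size_XnsubC.
Qed.

Lemma sqrt_embE a : emb a = in_qpoly p a%:P.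
Proof.
apply: val_inj; rewrite /= Pdiv.CommonRing.rmodp_small //.
apply: leq_ltn_trans (size_mk_monic_gt1 p); exact: size_polyC_leq1.
Qed.

Lemma sqr_sqrt_gen : sqrt_gen ^+ 2 = emb d.
Proof.
rewrite sqrt_embE /sqrt_gen -[LHS](rmorphXn (in_qpoly p)) /=.
apply/eqP; rewrite -subr_eq0 -[X in X == _](rmorphB (in_qpoly p)) /=.
apply/eqP/val_inj => /=; rewrite mk_monic_sqrt_poly.
by apply/eqP; have := sqrt_poly_dvd d; rewrite Pdiv.Idomain.dvdpE.
Qed.

Lemma sqrt_ext_lin a b : emb a + sqrt_gen * emb b = in_qpoly p (a%:P + 'X * b%:P).
Proof. by rewrite !sqrt_embE rmorphD rmorphM. Qed.

Lemma size_lin_poly (a b : E) : (size (a%:P + 'X * b%:P)%R <= 2)%N.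
Proof.
rewrite addrC mulrC; apply: leq_trans (size_polyD _ _) _; rewrite geq_max.
apply/andP; split; last exact: leq_trans (size_polyC_leq1 _) _.
by rewrite mul_polyC (leq_trans (size_scale_leq _ _)) ?size_polyX.
Qed.

Lemma sqrt_extP (x : sqrt_ext d) : exists a b, x = emb a + sqrt_gen * emb b.
Proof.
exists (val x)`_0, (val x)`_1; rewrite sqrt_ext_lin.
have sx : (size (val x) < size (mk_monic p))%N := size_mk_monic x.
have -> : ((val x)`_0)%:P + 'X * ((val x)`_1)%:P = val x.
  apply/polyP => i; rewrite coefD coefC coefXM coefC.
  case: i => [|[|i]] //=; rewrite ?addr0 ?add0r // nth_default //.
  have le3 : (size (mk_monic p) <= 3)%N.
    by rewrite mk_monic_sqrt_poly size_sqrt_poly_le3.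
  by have := leq_trans sx le3; rewrite ltnS => /leq_trans->.
by apply: val_inj; rewrite /= Pdiv.CommonRing.rmodp_small.
Qed.

(** The two cases are degree 1 and degree 2 of [sqrt_poly d], that is, d a square in E or not. *)
Lemma sqrt_ext_free : (exists r, sqrt_gen = emb r) \/
  (forall a b, emb a + sqrt_gen * emb b = 0 -> a = 0 /\ b = 0).
Proof.
have [lt2|] := ltnP (size p) 3.
  left; exists (val sqrt_gen)`_0; apply: val_inj; rewrite /= -size1_polyC //.
  have le2 : (size (mk_monic p) <= 2)%N by rewrite mk_monic_sqrt_poly.
  exact: leq_trans (size_mk_monic sqrt_gen) le2.
move=> ge3; right => a b; rewrite sqrt_ext_lin => /(congr1 val) /=.
rewrite mk_monic_sqrt_poly Pdiv.CommonRing.rmodp_small ?(leq_ltn_trans (size_lin_poly a b)) //.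
move=> e; split.
  by have := congr1 (fun q : {poly E} => q`_0) e; rewrite coefD coefC coefXM /= coef0 addr0.
by have := congr1 (fun q : {poly E} => q`_1) e; rewrite coefD coefC coefXM coefC /= coef0 add0r.
Qed.

(** Write v = g + sqrt(d) h and expand A(v, v): the two equations are the coefficients of 1 and of 2
    sqrt(d). *)
Lemma sqrt_ext_iso n (A : 'M[E]_n) : 2%:R != 0 :> E -> A^T = A ->
  mxiso (map_mx emb A) ->
  exists g h, [/\ (g != 0) || (h != 0), bil A g g + d * bil A h h = 0
                & bil A g h = 0].
Proof.
move=> two sA [v [v0 Av]].
have [g0 /choice [h0 gh]] := choice (fun i : 'I_n => sqrt_extP (v 0 i)).
pose g := \row_i g0 i; pose h := \row_i h0 i.
have ve : v = 1 *: map_mx emb g + sqrt_gen *: map_mx emb h.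
  by apply/rowP => i; rewrite scale1r !mxE gh.
have sA' : (map_mx emb A)^T = map_mx emb A by rewrite map_trmx sA.
have [[r er]|free] := sqrt_ext_free.
  have ve' : v = map_mx emb (g + r *: h).
    by rewrite ve er map_mxD map_mxZ scale1r.
  (* When the generator lies in E, v itself is defined over E, and h = 0 fits the same equations. *)
  exists (g + r *: h), 0; rewrite bil0 mulr0 addr0 (bilC _ _ sA) bil0; split=> //.
    by apply/orP; left; move: v0; rewrite ve' map_row_eq0 //; apply: fmorph_inj.
  by apply/eqP; rewrite -(fmorph_eq0 emb) -bil_map -ve' Av.
exists g, h; move: Av; rewrite ve bil_quadD // expr1n !mul1r sqr_sqrt_gen !bil_map.
rewrite addrAC -rmorphM -rmorphD -mulrnAr -rmorphMn /=.
move=> /free[-> /eqP]; rewrite -mulr_natr mulf_eq0 (negPf two) orbF => /eqP ->.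
split=> //.
move: v0; rewrite ve; apply: contraNT; rewrite negb_or !negbK => /andP[/eqP-> /eqP->].
by rewrite !map_mx0 !scaler0 addr0.
Qed.

End SqrtExtension.

(** * Polynomial extensions *)

Section LeadingTerm.
Variables (F : fieldType) (n N : nat) (A : 'M[F]_N).
Hypothesis anA : ~ mxiso A.
Local Notation MP := {mpoly F[n]}.
Local Notation AM := (map_mx (@mpolyC n F) A).

(** Let m be the largest leading exponent among the coordinates. The coefficient of m + m in the
    value is the form at the vector of m-coefficients. That vector is nonzero, so anisotropy
    prevents cancellation. *)
Lemma mlead_bil_aniso (u : 'rV[MP]_N) : u != 0 ->
  bil AM u u != 0 /\ exists m, mlead (bil AM u u) = (m + m)%MM.
Proof.
case/row_neq0P => i0 ui0.
have [i ui leui] := @arg_maxP _ _ _ i0 (fun j => u 0 j != 0)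
  (fun j => mlead (u 0 j)) ui0.
set m := mlead (u 0 i) in leui *.
have lem j : (mlead (u 0 j) <= m)%O.
  have [->|uj] := eqVneq (u 0 j) 0; last exact: leui.
  by rewrite mlead0 le0x.
have cm : (bil AM u u)@_(m + m) = bil A (map_mx (mcoeff m) u) (map_mx (mcoeff m) u).
  rewrite !bilE raddf_sum; apply: eq_bigr => j _ /=.
  rewrite raddf_sum; apply: eq_bigr => k _ /=; rewrite !mxE.
  by rewrite mulrAC [_ * (A j k)%:MP]mulrC mcoeffCM mleadcMW // mulrCA mulrA mulrAC.
have nz : bil A (map_mx (mcoeff m) u) (map_mx (mcoeff m) u) != 0.
  apply/eqP => e; apply: anA; exists (map_mx (mcoeff m) u); split=> //.
  by apply/row_neq0P; exists i; rewrite mxE mleadc_eq0.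
rewrite -cm in nz; split; first by apply: contraNneq nz => ->; rewrite mcoeff0.
exists m; apply/le_anti/andP; split; last first.
  by apply: msupp_le_mlead; rewrite mcoeff_msupp.
have le_sum I (G : I -> MP) r : (forall j, mlead (G j) <= (m + m)%MM)%O ->
    (mlead (\sum_(j <- r) G j) <= (m + m)%MM)%O.
  move=> leG; apply: (big_ind (fun p => mlead p <= (m + m)%MM)%O) => //.
    by rewrite mlead0 le0x.
  move=> p q lep leq; apply: le_trans (mleadD_le _ _) _.
  by rewrite leUx lep.
rewrite bilE; apply: (le_sum) => j; apply: le_sum => k.
rewrite !mxE mulrAC [_ * (A j k)%:MP]mulrC mul_mpolyC.
apply: le_trans (mleadZ_le _ _) _.
apply: le_trans (mleadM_le _ _) _.
exact: lem_add.
Qed.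

End LeadingTerm.

Lemma mpoly_rmorph_eq (R : comNzRingType) (S : comNzRingType) n
    (g h : {rmorphism {mpoly R[n]} -> S}) :
  (forall c, g c%:MP = h c%:MP) -> (forall i, g 'X_i = h 'X_i) -> g =1 h.
Proof.
move=> gC gX; elim/mpolyind => [|c m p _ _ IH]; first by rewrite !rmorph0.
rewrite !rmorphD IH -mul_mpolyC !rmorphM gC; congr (_ * _ + _).
by rewrite mpolyXE_id !rmorph_prod; apply: eq_bigr => i _; rewrite !rmorphXn gX.
Qed.

(** Divide by X as long as the vector vanishes at 0; the sum of the sizes of the entries
    decreases. *)
Lemma poly_row_strip (R : idomainType) n (u : 'rV[{poly R}]_n) : u != 0 ->
  exists e u', u = 'X^e *: u' /\ map_mx (horner_eval 0) u' != 0.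
Proof.
move=> u0; pose s := (\sum_i size (u 0%R i))%N.
have [k] := ubnP s; rewrite {}/s; elim: k => // k IH in u u0 *; rewrite ltnS => lek.
have [uz|] := eqVneq (map_mx (horner_eval 0) u) 0; last first.
  by exists 0%N, u; rewrite expr0 scale1r.
pose v := map_mx (drop_poly 1) u.
have uv : u = 'X *: v.
  apply/rowP => i; rewrite !mxE -{1}(poly_take_drop 1 (u 0 i)) expr1 mulrC.
  have -> : take_poly 1 (u 0 i) = 0; last by rewrite add0r.
  apply/polyP => -[|j]; rewrite coef_take_poly coef0 //=.
  by move/rowP/(_ i): uz; rewrite !mxE /horner_eval horner_coef0.
have v0 : v != 0 by apply: contraNneq u0 => vz; rewrite uv vz scaler0.
have [//||e [u' [ve u'0]]] := IH v; last first.
  by exists e.+1, u'; rewrite {1}uv ve scalerA -exprS.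
apply: leq_trans lek; have [i ui] := row_neq0P _ u0.
rewrite (bigD1 i) //= [X in (_ < X)%N](bigD1 i) //= -addSn.
apply: leq_add; last by apply: leq_sum => j _; rewrite mxE size_drop_poly leq_subr.
by rewrite mxE size_drop_poly subn1 prednK // size_poly_gt0.
Qed.

Lemma mpoly_mxiso (F : fieldType) n N (A : 'M[F]_N) :
  mxiso (map_mx (@mpolyC n F) A) -> mxiso A.
Proof.
case=> u [u0 Au]; apply: contrapT => anA.
by have [] := mlead_bil_aniso anA u0; rewrite Au eqxx.
Qed.

(* If A were anisotropic, the leading exponent would be even on the left-hand *)
(* side of the equation and odd on its right-hand side.                       *)
Lemma generic_multiple_iso (F : fieldType) N (A : 'M[F]_N)
    (g h : 'rV[{mpoly F[1]}]_N) :
  (g != 0) || (h != 0) ->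
  bil (map_mx (@mpolyC 1 F) A) g g = 'X_0 * bil (map_mx (@mpolyC 1 F) A) h h ->
  mxiso A.
Proof.
set AM := map_mx _ _ => gh e; apply: contrapT => anA.
have X0 : 'X_0 != 0 :> {mpoly F[1]} by rewrite -mleadc_eq0 mleadXm mcoeffX eqxx oner_eq0.
have g0 : g != 0.
  apply: contraLR gh => /negPn/eqP gz; rewrite gz eqxx /= negbK.
  apply: contraT => h0; have [] := mlead_bil_aniso (n := 1) anA h0.
  by move/eqP: e; rewrite gz bil0 eq_sym mulf_eq0 (negPf X0) /= => ->.
have [Ag [m em]] := mlead_bil_aniso (n := 1) anA g0.
have h0 : h != 0.
  by apply: contraNneq Ag => hz; rewrite e hz bil0 mulr0.
have [Ah [m' em']] := mlead_bil_aniso (n := 1) anA h0.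
move: em; rewrite e mleadM // em' mleadXm => /mnmP/(_ 0).
rewrite !mnmDE mnm1E eqxx !addnn => /(congr1 odd).
by rewrite oddD !odd_double.
Qed.

(** * Specialization of function fields *)

Lemma natr2_neq0 (K : fieldType) : 2%N \notin [pchar K] -> 2%:R != 0 :> K.
Proof. by apply: contraNneq => two; rewrite inE /= two eqxx. Qed.

Lemma rmorph2_neq0 (K F : fieldType) (f : {rmorphism K -> F}) :
  2%:R != 0 :> K -> 2%:R != 0 :> F.
Proof. by rewrite -(rmorph_nat f) fmorph_eq0. Qed.

Lemma bil_map_qdiag (K : fieldType) (R : comNzRingType) (f : {rmorphism K -> R})
    (s : seq K) (u v : 'rV[R]_(size s)) :
  bil (map_mx f (qmx (qdiag s))) u v = \sum_(i < size s) f s`_i * u 0 i * v 0 i.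
Proof.
rewrite bilE; apply: eq_bigr => i _; rewrite (bigD1 i) //= big1 => [|j ji].
  by rewrite addr0 !mxE eqxx mulr1n [_ * f _]mulrC.
by rewrite !mxE [i == j]eq_sym (negPf ji) mulr0n rmorph0 mulr0 mul0r.
Qed.

(* If the coordinate vanishes, reflect the isotropic vector in a suitable hyperplane. *)
Lemma qdiag_iso_coord0 (K F : fieldType) (f : {rmorphism K -> F}) b0 (b : seq K) :
  2%:R != 0 :> K -> all (fun x => x != 0) (b0 :: b) ->
  mxiso (map_mx f (qmx (qdiag (b0 :: b)))) ->
  exists w : 'rV_(size b).+1, w 0 0 != 0 /\ 
     f b0 * w 0 0 ^+ 2 + \sum_(i < size b) f b`_i * w 0 (lift ord0 i) ^+ 2 = 0.
Proof.
move=> /(rmorph2_neq0 f) two bnz [w [w0 Aw]].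
set A := map_mx _ _ in Aw.
suff [p [p0 Ap]] : exists p : 'rV_(size b).+1, p 0 0 != 0 /\ bil A p p = 0.
  exists p; split=> //; rewrite -[RHS]Ap bil_map_qdiag big_ord_recl.
  by congr (_ + _); [|apply: eq_bigr => i _]; rewrite -mulrA.
have [w00|] := eqVneq (w 0 0) 0; last by exists w.
have [i wi] := row_neq0P _ w0.
have i0 : i != 0 by apply: contraNneq wi => ->; rewrite w00.
pose x : 'rV[F]_(size b).+1 := delta_mx 0 0 + delta_mx 0 i.
pose B := bil A w x; pose Q := bil A x x.
have BE : B = f (b0 :: b)`_i * w 0 i.
  rewrite /B /A bil_map_qdiag (bigD1 i) //= (bigD1 0) 1?eq_sym //= big1.
    by rewrite w00 mulr0 mul0r !addr0 !mxE !eqxx (negPf i0) add0r mulr1.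
  by move=> j /andP[ji j0]; rewrite !mxE eqxx (negPf ji) (negPf j0) addr0 mulr0.
have sA : A^T = A by apply: map_qmxT.
(* This is the reflection of [w] along [x] multiplied by [Q], so it stays isotropic even if [Q] = 0.
   Its coordinate 0 is -2 [B], and [B] is b_i w_i up to the embedding. *)
exists (Q *: w + (- (B *+ 2)) *: x); split; last by rewrite bil_quadD // Aw -/B -/Q; ring.
rewrite !mxE !eqxx w00 mulr0 add0r [0 == i]eq_sym (negPf i0) addr0 mulr1 oppr_eq0.
rewrite -mulr_natr mulf_neq0 // BE mulf_neq0 // fmorph_eq0.
by move/allP: bnz; apply; rewrite mem_nth.
Qed.

Definition ff_poly (K : fieldType) (b : seq K) : {mpoly K[(size b).-1]} :=
  (- (b`_0)^-1)%:MP * \sum_(i < (size b).-1) (b`_i.+1)%:MP * 'X_i ^+ 2.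

Lemma ff_radicandE (K : fieldType) (b : seq K) :
  ff_radicand b = tofrac (ff_poly b).
Proof.
rewrite /ff_radicand /ff_poly rmorphM rmorph_sum -fmorphV -rmorphN; congr (_ * _).
by apply: eq_bigr => i _; rewrite rmorphM rmorphXn.
Qed.

(** The radicand is already a polynomial, and the equations of [sqrt_ext_iso] are homogeneous in (g,
    h), so a common denominator of g and h can be cleared. *)
Lemma ff_iso_poly (K : fieldType) (b : seq K) N (A : 'M[K]_N) :
  2%:R != 0 :> K -> A^T = A -> mxiso (map_mx (ff_emb b) A) ->
  exists g h, let AM := map_mx (@mpolyC (size b).-1 K) A in
    [/\ (g != 0) || (h != 0), bil AM g g + ff_poly b * bil AM h h = 0
      & bil AM g h = 0].
Proof.
move=> two sA; rewrite /ff_emb map_mx_comp; set n := (size b).-1; set AE := map_mx _ A.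
have sAE : AE^T = AE by rewrite map_trmx sA.
have twoE := rmorph2_neq0 (ratfun_const K n) two.
move/(sqrt_ext_iso twoE sAE) => [g [h [gh e1 e2]]].
have [c [g1 [c0 eg]]] := frac_row g; have [d [h1 [d0 eh]]] := frac_row h.
exists (d *: g1), (c *: h1); set AM := map_mx _ A; rewrite /=.
have ti : injective (@tofrac {mpoly K[n]}) by move=> x y /eqP; rewrite tofrac_eq => /eqP.
have AME : AE = map_mx (@tofrac _) AM by rewrite -map_mx_comp.
have bilG (u v : 'rV__) : tofrac (bil AM u v) =
    bil AE (map_mx (@tofrac _) u) (map_mx (@tofrac _) v) by rewrite AME bil_map.
have eg1 : map_mx (@tofrac _) (d *: g1) = (tofrac (c * d)) *: g.
  by rewrite map_mxZ -eg scalerA -rmorphM mulrC.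
have eh1 : map_mx (@tofrac _) (c *: h1) = (tofrac (c * d)) *: h.
  by rewrite map_mxZ -eh scalerA -rmorphM.
have cd0 : tofrac (c * d) != 0 by rewrite tofrac_eq0 mulf_neq0.
split.
- rewrite -(map_row_eq0 (d *: g1) ti) -(map_row_eq0 (c *: h1) ti) eg1 eh1.
  by rewrite !scaler_eq0 (negPf cd0).
- apply: ti; rewrite rmorph0 rmorphD rmorphM /= !bilG -ff_radicandE eg1 eh1.
  rewrite !bilZl !bilZr -[RHS](mulr0 (tofrac (c * d) ^+ 2)) -e1; ring.
- by apply: ti; rewrite rmorph0 bilG eg1 eh1 bilZl bilZr e2 !mulr0.
Qed.

Section Specialization.
Variables (K F : fieldType) (f : {rmorphism K -> F}) (m : nat) (w : 'I_m -> F).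
Local Notation R := {poly {mpoly F[m]}}.

Definition line_const : {rmorphism K -> R} := polyC \o @mpolyC m F \o f.

(** X_i goes to w_i + t S_i, where t is the variable of the outer polynomial ring: a generic line
    through the point w. Sending X_i directly to w_i could kill a nonzero vector; this map is
    injective and still reaches w at t = 0. *)
Definition line_subst : {rmorphism {mpoly K[m]} -> R} :=
  mmap line_const (fun i => (w i)%:MP%:P + 'X * ('X_i)%:P).

Lemma line_substC c : line_subst c%:MP = (f c)%:MP%:P.
Proof. exact: mmapC. Qed.

Lemma line_substX i : line_subst 'X_i = (w i)%:MP%:P + 'X * ('X_i)%:P.
Proof. by rewrite [LHS]mmapX mmap1U. Qed.

(** Setting t = 1 and translating S_i by -w_i sends the image of X_i back to X_i. *)
Lemma line_subst_inj : injective line_subst.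
Proof.
pose s : {rmorphism {mpoly F[m]} -> {mpoly F[m]}} :=
  mmap (@mpolyC m F) (fun i => 'X_i - (w i)%:MP).
have sK : s \o horner_eval 1 \o line_subst =1 map_mpoly f.
  apply: mpoly_rmorph_eq => [c|i].
    by rewrite /= line_substC /horner_eval hornerC map_mpolyC [LHS]mmapC.
  rewrite /= line_substX /horner_eval !hornerE map_mpolyX.
  by rewrite [LHS]rmorphD /= mmapC mmapX mmap1U addrC subrK.
have mi : injective (map_mpoly (n := m) f).
  by move=> p q e; apply/mpolyP => k; apply: (fmorph_inj f); rewrite -!mcoeff_map_mpoly e.
by move=> p q e; apply: mi; rewrite -!sK /= e.
Qed.

End Specialization.

Lemma rmorph_ff_poly (K : fieldType) (S : comNzRingType) (b : seq K)
    (h : {rmorphism {mpoly K[(size b).-1]} -> S}) :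
  h (ff_poly b) = h (- (b`_0)^-1)%:MP *
    \sum_(i < (size b).-1) h (b`_i.+1)%:MP * h 'X_i ^+ 2.
Proof.
rewrite /ff_poly rmorphM rmorph_sum; congr (_ * _).
by apply: eq_bigr => i _; rewrite rmorphM rmorphXn.
Qed.

Lemma line_subst_ff_poly_at0 (K F : fieldType) (f : {rmorphism K -> F}) b0
    (b : seq K) (x : F) (w : 'I_(size b) -> F) : b0 != 0 ->
  f b0 * x ^+ 2 + \sum_(i < size b) f b`_i * w i ^+ 2 = 0 ->
  (line_subst f w (ff_poly (b0 :: b))).[0] = (x ^+ 2)%:MP.
Proof.
move=> b00 ew; have fb0 : f b0 != 0 by rewrite fmorph_eq0.
rewrite (rmorph_ff_poly (b := b0 :: b) (line_subst f w)) line_substC hornerM hornerC.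
rewrite horner_sum (eq_bigr (fun i : 'I_(size b) => (f b`_i * w i ^+ 2)%:MP)).
  rewrite -rmorph_sum -rmorphM; congr (_%:MP).
  apply: (mulfI fb0); rewrite mulrA rmorphN fmorphV mulrN divff // mulN1r.
  by apply/eqP; rewrite eq_sym -addr_eq0 ew.
move=> i _; rewrite line_substC line_substX hornerM hornerC horner_exp hornerD.
by rewrite hornerC hornerM hornerX mul0r addr0 rmorphM rmorphXn.
Qed.

(** One power of t is removed from g and h jointly, so that they do not both vanish at t = 0. By
    homogeneity the equations survive the division. *)
Lemma specialize_at0 (R S : idomainType) (th : {rmorphism R -> {poly S}}) N
    (A : 'M[R]_N) (D : R) (g h : 'rV[R]_N) :
  injective th -> (g != 0) || (h != 0) ->
  bil A g g + D * bil A h h = 0 -> bil A g h = 0 ->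
  let A0 := map_mx (horner_eval 0 \o th) A in
  exists g0 h0, [/\ (g0 != 0) || (h0 != 0),
    bil A0 g0 g0 + (th D).[0] * bil A0 h0 h0 = 0 & bil A0 g0 h0 = 0].
Proof.
move=> thi gh e1 e2 A0; pose AR := map_mx th A.
have gh' : row_mx (map_mx th g) (map_mx th h) != 0.
  by apply: contraTneq gh => /eqP; rewrite row_mx_eq0 !map_row_eq0 // negb_or !negbK.
have [e [u [eu u0]]] := poly_row_strip gh'.
pose g1 := lsubmx u; pose h1 := rsubmx u.
have eg : map_mx th g = 'X^e *: g1 by rewrite /g1 -linearZ /= -eu row_mxKl.
have eh : map_mx th h = 'X^e *: h1 by rewrite /h1 -linearZ /= -eu row_mxKr.
have Xe : 'X^e ^+ 2 != 0 :> {poly S}.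
  by rewrite expf_neq0 // -size_poly_eq0 size_polyXn.
have e1' : bil AR g1 g1 + th D * bil AR h1 h1 = 0.
  apply: (mulfI Xe); rewrite mulr0 -[RHS](rmorph0 th) -e1 rmorphD rmorphM -!bil_map.
  by rewrite eg eh !bilZl !bilZr -/AR; ring.
have e2' : bil AR g1 h1 = 0.
  apply: (mulfI Xe); rewrite mulr0 -[RHS](rmorph0 th) -e2 -!bil_map.
  by rewrite eg eh !bilZl !bilZr -/AR; ring.
exists (map_mx (horner_eval 0) g1), (map_mx (horner_eval 0) h1).
have -> : A0 = map_mx (horner_eval 0) AR by rewrite /A0 map_mx_comp.
have ev x : x.[0] = horner_eval 0 x by [].
split; last by rewrite bil_map e2' rmorph0.
  apply: contraNT u0; rewrite negb_or !negbK => /andP[/eqP gz /eqP hz].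
  by rewrite -[u]hsubmxK map_row_mx gz hz row_mx0.
by rewrite !bil_map ev -rmorphM -rmorphD e1' rmorph0.
Qed.

Lemma scale_row_eq0 (R : idomainType) n (c : R) (v : 'rV[R]_n) :
  c != 0 -> c *: v = 0 -> v = 0.
Proof.
move=> c0 /rowP cv; apply/rowP => i; have := cv i; rewrite !mxE => /eqP.
by rewrite mulf_eq0 (negPf c0) => /eqP.
Qed.

(** An isotropic point of [qdiag b] over F with w_0 nonzero specializes the radicand to the square
    w_0^2, so the quadratic extension disappears and isotropy descends to F[S], then to F. *)
Lemma ff_iso_specialize (K F : fieldType) (f : {rmorphism K -> F}) (b : seq K)
    N (A : 'M[K]_N) :
  2%:R != 0 :> K -> A^T = A -> all (fun x => x != 0) b -> (0 < size b)%N ->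
  mxiso (map_mx (ff_emb b) A) -> mxiso (map_mx f (qmx (qdiag b))) ->
  mxiso (map_mx f A).
Proof.
case: b => // b0 b two sA bnz _ /(ff_iso_poly two sA) /=; set m := size b.
move=> [g [h [gh e1 e2]]] /(qdiag_iso_coord0 two bnz) [w [w0 ew]].
have [g0 [h0]] := specialize_at0 (line_subst_inj (f := f)
  (w := fun i => w 0 (lift ord0 i))) gh e1 e2.
pose AF := map_mx (@mpolyC m F) (map_mx f A).
rewrite -map_mx_comp (_ : map_mx _ A = AF); last first.
  apply/matrixP => i j; rewrite !mxE /= line_substC.
  by rewrite /horner_eval hornerC.
have b00 : b0 != 0 by case/andP: bnz.
rewrite (_ : _.[0] = (w 0 0 ^+ 2)%:MP); last first.
  exact: line_subst_ff_poly_at0 ew.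
case=> gh0 q1 q2; apply: contrapT => an.
have sAF : AF^T = AF by rewrite !map_trmx sA.
(* Since g0 and h0 are orthogonal, g0 + c h0 has value 0 for c = w_0 and c = -w_0. Anisotropy makes
   both vectors zero, hence g0 = h0 = 0. *)
have anM (c : F) : c ^+ 2 = w 0 0 ^+ 2 -> g0 + c%:MP *: h0 = 0.
  move=> ec; apply: contrapT => /eqP nz; apply/an/(@mpoly_mxiso _ m).
  exists (1 *: g0 + c%:MP *: h0); rewrite bil_quadD // scale1r; split=> //.
  have -> : c%:MP_[m] ^+ 2 = (w 0 0 ^+ 2)%:MP by rewrite -ec rmorphXn.
  by rewrite q2 mulr0 mul0rn addr0 expr1n mul1r.
have two2 : 2%:R != 0 :> {mpoly F[m]}.
  by rewrite -(rmorph_nat (@mpolyC m F)) mpolyC_eq0 (rmorph2_neq0 f).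
have wp := anM _ erefl; have wm := anM _ (sqrrN _).
have gz : g0 = 0.
  apply: (scale_row_eq0 two2); rewrite scaler_nat mulr2n.
  rewrite -[RHS](addr0 0) -{1}wp -wm rmorphN scaleNr addrACA subrr addr0 //.
have hz : h0 = 0.
  by apply: (@scale_row_eq0 _ _ (w 0 0)%:MP); rewrite ?mpolyC_eq0 // -wp gz add0r.
by move: gh0; rewrite gz hz eqxx.
Qed.

(** * Diagonalization and stable birational equivalence *)

Lemma bil_zero (K : fieldType) n (A : 'M[K]_n) : 2%:R != 0 :> K -> A^T = A ->
  (forall v, bil A v v = 0) -> A = 0.
Proof.
move=> two sA qA; apply/matrixP => i j; rewrite mxE.
have := qA (1 *: delta_mx 0 i + 1 *: delta_mx 0 j).
rewrite bil_quadD // !qA !mulr0 add0r addr0 !mul1r -mulr_natr => /eqP.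
rewrite mulf_eq0 (negPf two) orbF => /eqP <-.
by rewrite /bil -rowE trmx_delta -colE !mxE.
Qed.

Lemma sym_diagonalize (K : fieldType) n (A : 'M[K]_n) :
  2%:R != 0 :> K -> A^T = A ->
  exists P d, P \in unitmx /\ P *m A *m P^T = diag_mx d.
Proof.
move=> two; elim: n => [|n IH] in A * => sA.
  by exists 1%:M, 0; rewrite unitmx1; split=> //; apply/matrixP => -[].
case: (pselect (exists v, bil A v v != 0)) => [[v Av]|nv]; last first.
  exists 1%:M, 0; rewrite unitmx1 (_ : A = 0) ?mulmx0 ?mul0mx; last first.
    apply: bil_zero => // v; apply/eqP/negPn/negP => Av; apply: nv.
    by exists v.
  by split=> //; apply/matrixP => i j; rewrite !mxE mul0rn.
have v0 : v != 0 by apply: contraNneq Av => ->; rewrite bil0.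
(* A basis whose first row is proportional to v, so the corner entry [a] of the new Gram matrix is
   nonzero. *)
pose P0 : 'M_(1 + n) := row_ebase v.
have P0u : P0 \in unitmx by apply: row_ebase_unit.
have [A1 A1P] : exists B : 'M_(1 + n), B = P0 *m A *m P0^T by eexists.
have sA1 : A1^T = A1 by rewrite A1P !trmx_mul trmxK sA mulmxA.
pose a := A1 0 0.
have a0 : a != 0.
  have aE : a = bil A (row 0 P0) (row 0 P0).
    by rewrite /a A1P /bil -row_mul [in LHS]mxE [in RHS]mxE; apply: eq_bigr => j _; rewrite !mxE.
  apply: contraNneq Av => az; have := mulmx_ebase v.
  rewrite rank_rV v0 [col_ebase v]mx11_scalar mul_scalar_mx -scalemxAl.
  have -> : pid_mx 1 = delta_mx 0 0 :> 'M[K]_(1, n.+1).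
    by apply/matrixP => i j; rewrite !mxE ord1 [j == 0]eq_sym -val_eqE /= andbT.
  by rewrite -rowE => <-; rewrite bilZl bilZr -/P0 -aE az !mulr0.
pose u : 'rV_n := ursubmx A1; pose D : 'M_n := drsubmx A1.
have A1E : A1 = block_mx a%:M u u^T D.
  rewrite -[LHS]submxK; congr block_mx.
    by apply/matrixP => i j; rewrite !ord1 !mxE /= mulr1n /a; congr (A1 _ _); apply: val_inj.
  by rewrite /u trmx_ursub sA1.
(* One elimination step: it clears the first row and column and leaves the Schur complement of
   [a]. *)
pose C : 'M_(1 + n) := block_mx 1%:M 0 (- a^-1 *: u^T) 1%:M.
have CA : C *m A1 *m C^T = block_mx a%:M 0 0 (D - a^-1 *: (u^T *m u)).
  rewrite A1E /C tr_block_mx !mulmx_block trmx1 trmx0 !mul1mx !mul0mx !mulmx1 !mulmx0.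
  rewrite !addr0 linearZ /= trmxK mul_mx_scalar mul_scalar_mx !scalerA.
  rewrite mulrN divff // !scaleN1r !addNr mul0mx add0r.
  by rewrite !trmx1 !mulmx1 addNr -scalemxAl scaleNr addrC.
have [|P [d [Pu Pd]]] := IH (D - a^-1 *: (u^T *m u)).
  by rewrite linearB linearZ /= trmx_mul trmxK /D trmx_drsub sA1.
pose P1 : 'M_(1 + n) := block_mx 1%:M 0 0 P.
have P1u : P1 \in unitmx by rewrite unitmxE /P1 det_lblock det1 mul1r -unitmxE.
have Cu : C \in unitmx by rewrite unitmxE /C det_lblock !det1 mul1r unitr1.
have PCu : P1 *m C *m P0 \in unitmx by rewrite !unitmx_mul P1u Cu.
exists (P1 *m C *m P0), (row_mx a%:M d); split=> //.
have -> : P1 *m C *m P0 *m A *m (P1 *m C *m P0)^T = P1 *m (C *m A1 *m C^T) *m P1^T.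
  by rewrite A1P !trmx_mul !mulmxA.
rewrite CA.
rewrite /P1 tr_block_mx trmx1 !trmx0 !mulmx_block !mul1mx !mul0mx !mulmx0 !mulmx1.
rewrite !addr0 !add0r ?mul0mx ?mul1mx ?mulmx1 ?mulmx0 Pd (diag_mx_row (a%:M : 'rV_1) d).
suff -> : diag_mx (a%:M : 'rV_1) = a%:M by [].
by apply/matrixP => i j; rewrite !ord1 !mxE eqxx.
Qed.

Lemma qdiag_exists (K : fieldType) (q : qform K) : 2%:R != 0 :> K ->
  exists b, qisometric q (qdiag b).
Proof.
case: q => n A sA two; have [P [d [Pu PA]]] := sym_diagonalize two (eqP sA).
pose b := [seq d 0 i | i <- enum 'I_n].
have sb : n = size b by rewrite size_map size_enum_ord.
have bE (i : 'I_n) : b`_i = d 0 i.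
  by rewrite (nth_map i) ?size_enum_ord // nth_ord_enum.
(* [b] is generalized so that n can be replaced by [size b] in the types of the matrices. *)
exists b; move: b sb bE => b sb; rewrite /qisometric /=; subst n => bE.
exists (invmx P); rewrite row_free_unit row_full_unit !unitmx_inv; split=> //.
have -> : diag_mx (\row_(i < size b) b`_i) = P *m A *m P^T.
  by rewrite PA; congr diag_mx; apply/rowP => i; rewrite mxE bE.
by rewrite trmx_inv !mulmxA mulVmx // mul1mx mulmxK // unitmx_tr.
Qed.

Lemma isometric_qdim (K : fieldType) (q r : qform K) :
  qisometric q r -> qdim q = qdim r.
Proof. by case=> P [/eqP e1 /eqP e2 _]; rewrite -e1 e2. Qed.

Lemma isometric_nondegenerate (K : fieldType) (q r : qform K) :
  qisometric q r -> qnondegenerate q = qnondegenerate r.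
Proof.
move=> e; have := isometric_qdim e; case: q r e => m A sA [n B sB] [] /= P [] /=.
move=> fP _ e mn; rewrite /qnondegenerate /=.
subst n; rewrite row_free_unit in fP; rewrite e !unitmx_mul fP unitmx_tr fP.
by rewrite andbT.
Qed.

Lemma qdiag_nondegenerate (K : fieldType) (b : seq K) :
  qnondegenerate (qdiag b) = all (fun x => x != 0) b.
Proof.
rewrite /qnondegenerate /= unitmxE det_diag unitfE; apply/idP/allP => [/prodf_neq0 h x|h].
  by move/(nthP 0) => [i ib <-]; have := h (Ordinal ib) isT; rewrite mxE.
by apply/prodf_neq0 => i _; rewrite mxE h // mem_nth.
Qed.

Lemma isometric_iso (K F : fieldType) (f : {rmorphism K -> F}) (q r : qform K) :
  qisometric q r -> qisotropic (qbase f q) <-> qisotropic (qbase f r).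
Proof.
case=> P [/row_freeP[Q PQ] /row_fullP[Q' QP] e].
pose Pf := map_mx f P.
have bilP u v : bil (map_mx f (qmx q)) u v = bil (map_mx f (qmx r)) (u *m Pf) (v *m Pf).
  by rewrite /bil e !map_mxM trmx_mul -map_trmx !mulmxA.
split=> -[v [v0 Av]].
  exists (v *m Pf); split; last by rewrite -[LHS]bilP.
  apply: contraNneq v0 => vP; rewrite -[v]mulmx1 -(map_mx1 f) -PQ map_mxM mulmxA.
  by rewrite vP mul0mx.
have vE : v *m map_mx f Q' *m Pf = v by rewrite -mulmxA -map_mxM QP map_mx1 mulmx1.
exists (v *m map_mx f Q'); split; last by rewrite [LHS]bilP vE.
by apply: contraNneq v0 => z; rewrite -vE z mul0mx.
Qed.

(** The tautological zero (sqrt(D), Y_2, ..., Y_m), with D the radicand; it is nonzero because at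
    least one variable occurs. *)
Lemma ff_self_iso (K : fieldType) (b : seq K) : (1 < size b)%N ->
  all (fun x => x != 0) b -> qisotropic (qbase (ff_emb b) (qdiag b)).
Proof.
case: b => [|b0 [|b1 b]] //= _; set s := [:: b0, b1 & b] => bnz.
pose v : 'rV[function_field s]_(size s).-1.+1 :=
  \row_i oapp (fun j => sqrt_emb (ff_radicand s) (ratfun_var K j))
     (sqrt_gen (ff_radicand s)) (unlift ord0 i).
exists v; split.
  apply/row_neq0P; exists (lift ord0 ord0); rewrite mxE liftK /= fmorph_eq0.
  by rewrite tofrac_eq0 -mleadc_eq0 mleadXm mcoeffX eqxx oner_eq0.
rewrite [LHS]bil_map_qdiag big_ord_recl mxE unlift_none /=.
have c0 : ratfun_const K (size s).-1 b0 != 0 by rewrite fmorph_eq0; case/andP: bnz.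
rewrite -mulrA -expr2 sqr_sqrt_gen -rmorphM.
rewrite (eq_bigr (fun i : 'I_(size s).-1 => sqrt_emb (ff_radicand s)
   (ratfun_const K (size s).-1 s`_i.+1 * ratfun_var K i ^+ 2))).
  rewrite -rmorph_sum -rmorphD /ff_radicand /= mulrA mulrN divff // mulN1r addNr.
  by rewrite rmorph0.
by move=> i _; rewrite mxE liftK /= rmorphM rmorphXn -mulrA.
Qed.

Definition iso_equiv (K : fieldType) (phi psi : qform K) : Prop :=
  forall (F : fieldType) (f : {rmorphism K -> F}),
    qisotropic (qbase f phi) <-> qisotropic (qbase f psi).

(** Each half of [stb] says that p is isotropic wherever q is: specialize the function field of q in
    one direction, and take F to be that function field in the other. *)
Lemma stbP (K : fieldType) (phi psi : qform K) : 2%:R != 0 :> K ->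
  qnondegenerate phi -> qnondegenerate psi ->
  (1 < qdim phi)%N -> (1 < qdim psi)%N ->
  stb phi psi <-> iso_equiv phi psi.
Proof.
move=> two.
suff H (p q : qform K) : qnondegenerate q -> (1 < qdim q)%N ->
    qisotropic_over_ff p q <->
    (forall (F : fieldType) (f : {rmorphism K -> F}),
      qisotropic (qbase f q) -> qisotropic (qbase f p)).
  move=> np nq dp dq; rewrite /stb !H //; split=> [[h1 h2] F f|h]; split; auto.
    by move=> F f; case: (h F f).
  by move=> F f; case: (h F f).
move=> nq dq; split=> [[b [qb pi]] F f qi|h].
  apply: (ff_iso_specialize (b := b)) => //; first exact: qmxT.
  - by rewrite -qdiag_nondegenerate -(isometric_nondegenerate qb).
  - by rewrite -[size b]/(qdim (qdiag b)) -(isometric_qdim qb) ltnW.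
  - exact/(isometric_iso f qb).
have [b qb] := qdiag_exists q two; exists b; split=> //; apply: h.
apply/(isometric_iso _ qb)/ff_self_iso.
  by rewrite -[size b]/(qdim (qdiag b)) -(isometric_qdim qb).
by rewrite -qdiag_nondegenerate -(isometric_nondegenerate qb).
Qed.

(** * Tensor products *)

(** Tensor products are commutative, associative and unital only up to renumbering the basis, and
    the dimensions differ as terms; isotropy ignores the renumbering. *)
Lemma mxiso_bij (K : fieldType) m n (A : 'M[K]_m) (B : 'M[K]_n) (h : 'I_m -> 'I_n) :
  bijective h -> (forall i j, A i j = B (h i) (h j)) -> mxiso A <-> mxiso B.
Proof.
suff H p q (M : 'M[K]_p) (N : 'M[K]_q) (l : 'I_p -> 'I_q) : bijective l ->
    (forall i j, M i j = N (l i) (l j)) -> mxiso N -> mxiso M.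
  move=> bh AB; split; last exact: H bh AB.
  case: (bh) => k hk kh; apply: (H _ _ _ _ k) => [|i j]; first by exists h.
  by rewrite AB !kh.
move=> bl MN [v [v0 Nv]]; exists (\row_i v 0 (l i)); split.
  have [j vj] := row_neq0P _ v0; apply/row_neq0P; case: bl => k lk kl.
  by exists (k j); rewrite mxE kl.
rewrite -Nv !bilE [RHS](reindex l) /=; last exact: onW_bij.
apply: eq_bigr => i _; rewrite [RHS](reindex l) /=; last exact: onW_bij.
by apply: eq_bigr => j _; rewrite !mxE MN.
Qed.

Lemma mxiso_tensC (K : fieldType) m n (A : 'M[K]_m) (B : 'M[K]_n) :
  mxiso (A *t B) <-> mxiso (B *t A).
Proof.
apply: (@mxiso_bij _ _ _ _ _ (fun k => mxtens_index
  ((mxtens_unindex k).2, (mxtens_unindex k).1))).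
  by exists (fun k => mxtens_index ((mxtens_unindex k).2, (mxtens_unindex k).1)) => k;
    rewrite mxtens_indexK -surjective_pairing mxtens_unindexK.
move=> i j; case: (mxtens_indexP i) => i1 i2; case: (mxtens_indexP j) => j1 j2.
by rewrite !mxtens_indexK /= !tensmxE mulrC.
Qed.

Lemma mxiso_tensA (K : fieldType) m n p (A : 'M[K]_m) (B : 'M[K]_n) (C : 'M[K]_p) :
  mxiso (A *t B *t C) <-> mxiso (A *t (B *t C)).
Proof.
pose l (k : 'I_(m * n * p)) : 'I_(m * (n * p)) :=
  let ab := mxtens_unindex (mxtens_unindex k).1 in
  mxtens_index (ab.1, mxtens_index (ab.2, (mxtens_unindex k).2)).
pose r (k : 'I_(m * (n * p))) : 'I_(m * n * p) :=
  let bc := mxtens_unindex (mxtens_unindex k).2 in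
  mxtens_index (mxtens_index ((mxtens_unindex k).1, bc.1), bc.2).
have lE x y z : l (mxtens_index (mxtens_index (x, y), z)) =
    mxtens_index (x, mxtens_index (y, z)) by rewrite /l !mxtens_indexK.
have rE x y z : r (mxtens_index (x, mxtens_index (y, z))) =
    mxtens_index (mxtens_index (x, y), z) by rewrite /r !mxtens_indexK.
apply: (@mxiso_bij _ _ _ _ _ l).
  exists r => k; case: (mxtens_indexP k) => x y.
    by case: (mxtens_indexP x) => x1 x2; rewrite lE rE.
  by case: (mxtens_indexP y) => y1 y2; rewrite rE lE.
move=> i j; case: (mxtens_indexP i) => x y; case: (mxtens_indexP x) => x1 x2.
case: (mxtens_indexP j) => x' y'; case: (mxtens_indexP x') => x1' x2'.
by rewrite !lE !tensmxE mulrA.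
Qed.

Lemma mxiso_tens1 (K : fieldType) n (A : 'M[K]_n) :
  mxiso (qmx (qdiag [:: 1]) *t A) <-> mxiso A.
Proof.
apply: (@mxiso_bij _ (1 * n) n _ _ (fun k => (@mxtens_unindex 1 n k).2)).
  exists (fun k => @mxtens_index 1 n (ord0, k)) => k; last by rewrite mxtens_indexK.
  by case: (@mxtens_indexP 1 n k) => x y; rewrite mxtens_indexK /= [x]ord1.
move=> i j; case: (@mxtens_indexP 1 n i) => x y; case: (@mxtens_indexP 1 n j) => x' y'.
by rewrite !mxtens_indexK /= (@tensmxE _ 1 1 n n) !ord1 !mxE eqxx mulr1n mul1r.
Qed.

Lemma mxiso_scale (K : fieldType) n (c : K) (A : 'M[K]_n) : c != 0 ->
  mxiso (c *: A) <-> mxiso A.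
Proof.
move=> c0; have bilc v : bil (c *: A) v v = c * bil A v v.
  by rewrite /bil -scalemxAr -scalemxAl mxE.
split=> -[v [v0 Av]]; exists v; split=> //; last by rewrite bilc Av mulr0.
by apply/eqP; move/eqP: Av; rewrite bilc mulf_eq0 (negPf c0).
Qed.

Lemma mxiso_block (K : fieldType) m n (A : 'M[K]_m) (B : 'M[K]_n) :
  mxiso (block_mx A 0 0 B) <->
  exists v w, (v != 0) || (w != 0) /\ bil A v v + bil B w w = 0.
Proof.
have bilb v w : bil (block_mx A 0 0 B) (row_mx v w) (row_mx v w) = bil A v v + bil B w w.
  rewrite /bil mul_row_block !mulmx0 addr0 add0r tr_row_mx mul_row_col mxE.
  by [].
split=> [[u]|[v [w [vw e]]]].
  rewrite -[u]hsubmxK bilb row_mx_eq0 negb_and => -[u0 e].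
  by exists (lsubmx u), (rsubmx u).
by exists (row_mx v w); rewrite row_mx_eq0 negb_and bilb.
Qed.

(** <<c>> tensored with A is the orthogonal sum of A and -cA. *)
Lemma binary_tens_iso (K : fieldType) (c : K) n (A : 'M[K]_n) :
  mxiso (qmx (qdiag [:: 1; - c]) *t A) <->
  exists v w, (v != 0) || (w != 0) /\ bil A v v = c * bil A w w.
Proof.
have -> : mxiso (qmx (qdiag [:: 1; - c]) *t A) <-> mxiso (block_mx A 0 0 (- c *: A)).
  pose h (k : 'I_(2 * n)) : 'I_(n + n) :=
    let: (x, y) := @mxtens_unindex 2 n k in
    if x == 0 then lshift n y else rshift n y.
  pose r (k : 'I_(n + n)) : 'I_(2 * n) :=
    match split k with
    | inl y => @mxtens_index 2 n (0, y) | inr y => @mxtens_index 2 n (1, y) end.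
  apply: (@mxiso_bij _ (2 * n) (n + n) _ _ h).
    exists r => k; rewrite /h /r.
      case: (@mxtens_indexP 2 n k) => x y; rewrite mxtens_indexK.
      by case: x => -[|[|//]] lx; rewrite ?(unsplitK (inl y)) ?(unsplitK (inr y)) /=;
        congr (mxtens_index (_, _)); apply: val_inj.
    by case: (split_ordP k) => y ->; rewrite ?(unsplitK (inl y)) ?(unsplitK (inr y));
      rewrite mxtens_indexK.
  move=> i j; case: (@mxtens_indexP 2 n i) => x y; case: (@mxtens_indexP 2 n j) => x' y'.
  rewrite /h !mxtens_indexK (@tensmxE _ 2 2 n n).
  case: x => -[|[|//]] lx; case: x' => -[|[|//]] lx' /=;
    rewrite ?block_mxEul ?block_mxEur ?block_mxEdl ?block_mxEdr !mxE /=.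
  - by rewrite mulr1n mul1r.
  - by rewrite mulr0n mul0r.
  - by rewrite mulr0n mul0r.
  - by rewrite mulr1n.
have bilc v : bil (- c *: A) v v = - (c * bil A v v).
  by rewrite /bil -scalemxAr -scalemxAl mxE mulNr.
rewrite mxiso_block; split=> -[v [w [vw e]]]; exists v, w; split=> //.
  by move/eqP: e; rewrite bilc subr_eq0 => /eqP.
by rewrite bilc e subrr.
Qed.

Lemma map_qdiag (K F : fieldType) (f : {rmorphism K -> F}) c :
  map_mx f (qmx (qdiag [:: 1; - c])) = qmx (qdiag [:: 1; - f c]).
Proof.
apply/matrixP => i j; rewrite !mxE rmorphMn; congr (_ *+ _).
by case: i => -[|[|//]] li /=; rewrite ?rmorph1 ?rmorphN.
Qed.

(** * Forms that become isotropic over the same extensions *)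

Section IsoEquiv.
Variable K : fieldType.
Implicit Types p q r : qform K.

Lemma iso_equiv_sym p q : iso_equiv p q -> iso_equiv q p.
Proof. by move=> pq F f; rewrite (pq F f). Qed.

Lemma iso_equiv_trans p q r : iso_equiv p q -> iso_equiv q r -> iso_equiv p r.
Proof. by move=> pq qr F f; rewrite (pq F f). Qed.

Lemma iso_equiv_tensC p q : iso_equiv (qtensor p q) (qtensor q p).
Proof.
move=> F f; rewrite -[qisotropic _]/(mxiso (map_mx f (qmx p *t qmx q))).
rewrite -[qisotropic (qbase f (qtensor q p))]/(mxiso (map_mx f (qmx q *t qmx p))).
by rewrite !map_mxT; apply: mxiso_tensC.
Qed.

Lemma iso_equiv_isometric p q : qisometric p q -> iso_equiv p q.
Proof. by move=> pq F f; apply: isometric_iso. Qed.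

Lemma isometric_tens p q r : qisometric p q -> qisometric (qtensor p r) (qtensor q r).
Proof.
case=> P [/row_freeP[Q PQ] /row_fullP[Q' QP] e]; exists (P *t (1%:M : 'M_(qdim r))).
have t1 m n : (1%:M : 'M[K]_m) *t (1%:M : 'M_n) = 1%:M.
  apply/matrixP => i j; case: (mxtens_indexP i) => i1 i2.
  case: (mxtens_indexP j) => j1 j2; rewrite tensmxE !mxE.
  by rewrite -natrM mulnb (can_eq (@mxtens_indexK m n)).
split=> /=.
- by apply/row_freeP; exists (Q *t 1%:M); rewrite tensmx_mul PQ mulmx1 t1.
- by apply/row_fullP; exists (Q' *t 1%:M); rewrite tensmx_mul QP mulmx1 t1.
- by rewrite trmx_tens !tensmx_mul e trmx1 mul1mx mulmx1.
Qed.

Lemma iso_equiv_scale c p r : c != 0 ->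
  iso_equiv (qtensor (qscale c p) r) (qtensor p r).
Proof.
move=> c0 F f; have fc0 : f c != 0 by rewrite fmorph_eq0.
suff H : map_mx f ((c *: qmx p) *t qmx r) = f c *: map_mx f (qmx p *t qmx r).
  by have := mxiso_scale (map_mx f (qmx p *t qmx r)) fc0; rewrite -H.
by apply/matrixP => i j; rewrite !mxE -rmorphM -mulrA.
Qed.

End IsoEquiv.

(** On the plane of v and w the form is ca x^2 + 2b xy + a y^2, with a = A(w, w) and b = A(v, w); x
    = t - b, y = ca is a zero since t^2 = b^2 - ca^2. This vector is nonzero, even for dependent v
    and w, because its product with v is ca t. *)
Lemma sqrt_iso_vector (F L : fieldType) (S : {rmorphism F -> L}) n (A : 'M[F]_n)
    (v w : 'rV[F]_n) (c : F) (t : L) :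
  A^T = A -> bil A v v = c * bil A w w -> bil A v v != 0 -> t != 0 ->
  t ^+ 2 = S (bil A v w ^+ 2 - c * bil A w w ^+ 2) -> mxiso (map_mx S A).
Proof.
move=> sA e av t0 et; have sAS : (map_mx S A)^T = map_mx S A by rewrite map_trmx sA.
set a := bil A w w in e et; set b := bil A v w in et.
exists ((t - S b) *: map_mx S v + S (c * a) *: map_mx S w); split.
  apply/eqP => z0.
  have := bil0 (map_mx S A) (map_mx S v); rewrite -z0.
  rewrite bilDl !bilZl !bil_map (bilC w v sA) -/b -e mulrC -mulrDr subrK => /eqP.
  by rewrite mulf_eq0 fmorph_eq0 (negPf av) (negPf t0).
rewrite bil_quadD // !bil_map e -/a -/b rmorphM.
have -> : (t - S b) ^+ 2 = t ^+ 2 - t * S b *+ 2 + S b ^+ 2 by ring.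
by rewrite et rmorphB rmorphXn rmorphM rmorphXn; ring.
Qed.

(* With a = phi(w), b the polar form at (v, w) and d = b^2 - c a^2, an equality *)
(* phi(v) = c phi(w) makes phi isotropic over F(sqrt d); conversely              *)
(* psi(g) = - d psi(h) with g orthogonal to h gives                              *)
(* psi(g + b h) = (b^2 - d) psi(h) = c psi(a h).                                 *)
Lemma binary_tens_step (K F : fieldType) (f : {rmorphism K -> F}) (phi psi : qform K) c :
  2%:R != 0 :> K -> (0 < qdim psi)%N ->
  iso_equiv phi psi -> c != 0 ->
  mxiso (qmx (qdiag [:: 1; - c]) *t map_mx f (qmx phi)) ->
  mxiso (qmx (qdiag [:: 1; - c]) *t map_mx f (qmx psi)).
Proof.
move=> two dpsi eqv c0; have twoF := rmorph2_neq0 f two.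
set A := map_mx f (qmx phi); set B := map_mx f (qmx psi).
have sA : A^T = A by apply: map_qmxT.
have sB : B^T = B by apply: map_qmxT.
move=> /binary_tens_iso[v [w [vw e]]]; apply/binary_tens_iso.
(* If phi(w) = 0 then phi(v) = 0 too, so phi is isotropic over F, and with it psi. *)
have [a0|a0] := eqVneq (bil A w w) 0.
  have /(eqv F f) [x [x0 xB]] : qisotropic (qbase f phi).
    have [v0|v0] := eqVneq v 0; last by exists v; split=> //; rewrite [LHS]e a0 mulr0.
    by exists w; split=> //; move: vw; rewrite v0 eqxx.
  by exists x, 0; rewrite x0 bil0 mulr0.
set a := bil A w w in e a0; pose b := bil A v w.
pose d := b ^+ 2 - c * a ^+ 2.
(* If d = 0 then c = (b/a)^2, and every vector x gives psi((b/a) x) = c psi(x). *)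
have [d0|d0] := eqVneq d 0.
  pose x : 'rV[F]_(qdim psi) := const_mx 1.
  have x0 : x != 0 by apply/row_neq0P; exists (Ordinal dpsi); rewrite mxE oner_eq0.
  exists ((b / a) *: x), x; rewrite x0 orbT bilZl bilZr mulrA -expr2; split=> //.
  by congr (_ * _); apply: (mulIf (expf_neq0 2 a0)); rewrite -exprMn divfK //;
     apply/eqP; rewrite -subr_eq0 -/d d0.
have [|g [h [gh e1 e2]]] := sqrt_ext_iso twoF sB (d := d).
  rewrite -map_mx_comp; apply: (eqv _ (sqrt_emb d \o f)).1.
  have : mxiso (map_mx (sqrt_emb d) A); last by rewrite -map_mx_comp.
  apply: (sqrt_iso_vector (t := sqrt_gen d) sA e) => //; last exact: sqr_sqrt_gen.
    by rewrite e mulf_neq0.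
  by apply: contraNneq d0 => t0; rewrite -(fmorph_eq0 (sqrt_emb d)) -sqr_sqrt_gen t0 expr0n.
exists (1 *: g + b *: h), (a *: h); split.
  have [h0|h0] := eqVneq h 0; last by rewrite scaler_eq0 negb_or a0 h0 orbT.
  by move: gh; rewrite h0 eqxx orbF scale1r scaler0 addr0 => ->.
rewrite bil_quadD // e2 bilZl bilZr mulr0 mul0rn addr0 expr1n mul1r.
have -> : bil B g g = - d * bil B h h by apply/eqP; rewrite mulNr -addr_eq0 e1.
by rewrite /d; ring.
Qed.

(** * Pfister multiples and represented products *)

Lemma iso_equiv_binary_tens (K F : fieldType) (f : {rmorphism K -> F})
    (phi psi : qform K) c :
  2%:R != 0 :> K -> (0 < qdim phi)%N -> (0 < qdim psi)%N ->
  iso_equiv phi psi -> c != 0 ->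
  mxiso (qmx (qdiag [:: 1; - c]) *t map_mx f (qmx phi)) <->
  mxiso (qmx (qdiag [:: 1; - c]) *t map_mx f (qmx psi)).
Proof.
move=> two dphi dpsi eqv c0; split; apply: binary_tens_step => //.
exact: iso_equiv_sym.
Qed.

Lemma qdim_pfister_gt0 (K : fieldType) (s : seq K) : (0 < qdim (pfister s))%N.
Proof. by elim: s => //= a s IH; rewrite muln_gt0. Qed.

Lemma iso_equiv_base (K F : fieldType) (f : {rmorphism K -> F}) (phi psi : qform K) :
  iso_equiv phi psi -> iso_equiv (qbase f phi) (qbase f psi).
Proof.
move=> eqv G g; have := eqv G (g \o f).
rewrite -[qisotropic (qbase g _)]/(mxiso (map_mx g (map_mx f (qmx phi)))).
rewrite -[qisotropic (qbase g (qbase f psi))]/(mxiso (map_mx g (map_mx f (qmx psi)))).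
by rewrite -!map_mx_comp.
Qed.

(** Induction on the slots: <<a, s>> q is <<a>> applied to <<s>> q, and each binary factor preserves
    the equivalence. *)
Lemma iso_equiv_pfister (K : fieldType) (phi psi : qform K) (s : seq K) :
  2%:R != 0 :> K -> (0 < qdim phi)%N -> (0 < qdim psi)%N ->
  iso_equiv phi psi -> all (fun a => a != 0) s ->
  iso_equiv (qtensor (pfister s) phi) (qtensor (pfister s) psi).
Proof.
move=> two dphi dpsi eqv; elim: s => [_|a s IH /andP[a0 /IH {}IH]] F f.
  have tens1 (q : qform K) : qisotropic (qbase f (qtensor (pfister [::]) q)) <->
      qisotropic (qbase f q).
    rewrite -[X in X <-> _]/(mxiso (map_mx f (qmx (qdiag [:: 1]) *t qmx q))) map_mxT.
    have -> : map_mx f (qmx (qdiag [:: 1])) = qmx (qdiag [:: 1]).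
      by apply/matrixP => i j; rewrite !mxE !ord1 /= rmorphMn rmorph1.
    exact: mxiso_tens1.
  by rewrite !tens1.
have tensS (q : qform K) : qisotropic (qbase f (qtensor (pfister (a :: s)) q)) <->
    mxiso (qmx (qdiag [:: 1; - f a]) *t map_mx f (qmx (qtensor (pfister s) q))).
  rewrite -[X in X <-> _]/(mxiso (map_mx f
    (qmx (qdiag [:: 1; - a]) *t qmx (pfister s) *t qmx q))) !map_mxT map_qdiag.
  exact: mxiso_tensA.
rewrite !tensS; apply: iso_equiv_binary_tens => //; rewrite ?fmorph_eq0 //=.
  by rewrite muln_gt0 qdim_pfister_gt0.
by rewrite muln_gt0 qdim_pfister_gt0.
Qed.

Lemma qtensor_nondegenerate (K : fieldType) (p q : qform K) :
  (0 < qdim p)%N -> (0 < qdim q)%N ->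
  qnondegenerate p -> qnondegenerate q -> qnondegenerate (qtensor p q).
Proof. by rewrite !lt0n; apply: tensmx_unit. Qed.

Lemma pfister_nondegenerate (K : fieldType) (s : seq K) :
  all (fun a => a != 0) s -> qnondegenerate (pfister s).
Proof.
elim: s => [_|a s IH /andP[a0 /IH {}IH]]; first by rewrite qdiag_nondegenerate /= oner_eq0.
apply: qtensor_nondegenerate => //; first exact: qdim_pfister_gt0.
by rewrite qdiag_nondegenerate /= oner_eq0 oppr_eq0 a0.
Qed.

Lemma qbase_nondegenerate (K F : fieldType) (f : {rmorphism K -> F}) (q : qform K) :
  qnondegenerate q -> qnondegenerate (qbase f q).
Proof. by rewrite /qnondegenerate /= map_unitmx. Qed.

(** For v isotropic and w not orthogonal to v, the value at w + x v is linear in x with nonzero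
    slope. *)
Lemma isotropic_universal (K : fieldType) (q : qform K) c : 2%:R != 0 :> K ->
  qnondegenerate q -> qisotropic q -> exists v, bil (qmx q) v v = c.
Proof.
move=> two nq [v [v0 qv]]; set A := qmx q.
have sA : A^T = A by apply: qmxT.
have vA : v *m A != 0 by apply: contraNneq v0 => z; rewrite -[v](mulmxK nq) z mul0mx.
have [i vi] := row_neq0P _ vA.
pose w : 'rV[K]_(qdim q) := delta_mx 0 i.
have wv : bil A w v != 0 by rewrite bilC // /bil trmx_delta -colE mxE.
exists (1 *: w + ((c - bil A w w) / (2%:R * bil A w v)) *: v).
rewrite bil_quadD // [bil A v v]qv; field.
by rewrite two wv.
Qed.

(** If q(u) = a and q(v) = b, then q(b u) = ab q(v). Conversely c = q(v) / q(w), and 1/q(w) is the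
    value at w/q(w); if q(w) = 0, then q is isotropic, hence universal, and c = 1 c. *)
Lemma represents_mulP (K : fieldType) (q : qform K) c : 2%:R != 0 :> K ->
  qnondegenerate q ->
  qrepresents_mul q c <-> c != 0 /\ mxiso (qmx (qdiag [:: 1; - c]) *t qmx q).
Proof.
move=> two nq; rewrite binary_tens_iso; split.
  move=> [a [b [[a0 [u au]] [b0 [v bv]] ->]]]; split; first exact: mulf_neq0.
  have {}au : bil (qmx q) u u = a := au; have {}bv : bil (qmx q) v v = b := bv.
  exists (b *: u), v; split.
    by apply/orP; right; apply: contraNneq b0 => v0; rewrite -bv v0 bil0.
  by rewrite bilZl bilZr au bv; ring.
move=> [c0 [v [w [vw e]]]].
have [w0|w0] := eqVneq (bil (qmx q) w w) 0.
  have qi : qisotropic q.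
    have [v0|v0] := eqVneq v 0; last by exists v; split=> //; rewrite [LHS]e w0 mulr0.
    by exists w; split=> //; move: vw; rewrite v0 eqxx.
  exists 1, c; split; last by rewrite mul1r.
    by split; [exact: oner_neq0|exact: isotropic_universal].
  by split=> //; exact: isotropic_universal.
exists (bil (qmx q) v v), (bil (qmx q) w w)^-1; split.
- by split; [rewrite e mulf_neq0|exists v].
- split; first by rewrite invr_eq0.
  exists ((bil (qmx q) w w)^-1 *: w); rewrite [LHS]bilZl bilZr.
  by rewrite mulVf // mulr1.
- by rewrite e mulfK.
Qed.

(** After clearing denominators, q(g) = t q(h) contradicts the parity of leading exponents unless q
    is isotropic over F. *)
Lemma generic_tens_iso (F : fieldType) (q : qform F) :
  mxiso (qmx (qdiag [:: 1; - ratfun_var F (0 : 'I_1)]) *t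
         map_mx (ratfun_const F 1) (qmx q)) <-> qisotropic q.
Proof.
rewrite binary_tens_iso; split=> [[v [w [vw e]]]|[v [v0 qv]]]; last first.
  exists (map_mx (ratfun_const F 1) v), 0; rewrite bil0 mulr0 bil_map.
  rewrite map_row_eq0 ?v0; last exact: fmorph_inj.
  by rewrite [bil _ _ _]qv rmorph0.
have [c [g [c0 cg]]] := frac_row v; have [d [h [d0 dh]]] := frac_row w.
have ti : injective (@tofrac {mpoly F[1]}) by move=> x y /eqP; rewrite tofrac_eq => /eqP.
have cd0 : tofrac (c * d) != 0 by rewrite tofrac_eq0 mulf_neq0.
have ge : map_mx (@tofrac _) (d *: g) = tofrac (c * d) *: v.
  by rewrite map_mxZ -cg scalerA -rmorphM mulrC.
have he : map_mx (@tofrac _) (c *: h) = tofrac (c * d) *: w.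
  by rewrite map_mxZ -dh scalerA -rmorphM.
apply: (@generic_multiple_iso _ _ (qmx q) (d *: g) (c *: h)).
  rewrite -(map_row_eq0 (d *: g) ti) -(map_row_eq0 (c *: h) ti) ge he.
  by rewrite !scaler_eq0 (negPf cd0).
apply: ti; rewrite rmorphM -!bil_map ge he -map_mx_comp !bilZl !bilZr e.
by rewrite [RHS]mulrCA; congr (_ * _); rewrite [LHS]mulrCA.
Qed.

Lemma ratfun_extend (K F : fieldType) (f : {rmorphism K -> F}) n :
  exists g : {rmorphism ratfun K n -> ratfun F n},
    (forall c, g (ratfun_const K n c) = ratfun_const F n (f c)) /\
    (forall i, g (ratfun_var K i) = ratfun_var F i).
Proof.
pose h : {rmorphism {mpoly K[n]} -> ratfun F n} := @tofrac _ \o map_mpoly f.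
have hi : injective h.
  move=> p q /eqP; rewrite /h /= tofrac_eq => /eqP e; apply/mpolyP => m.
  by apply: (fmorph_inj f); rewrite -!mcoeff_map_mpoly e.
have [g gE] := frac_extend hi; exists g; split=> [c|i].
  by rewrite /ratfun_const /= gE /h /= map_mpolyC.
by rewrite /ratfun_var gE /h /= map_mpolyX.
Qed.

(** Given F/K, evaluate the hypothesis over the extension F(t) of K(t) and apply
    [generic_tens_iso]. *)
Lemma generic_pfister_iso_equiv (K : fieldType) (phi psi : qform K) :
  iso_equiv (qtensor (generic_pfister K 1) (qbase (ratfun_const K 1) phi))
            (qtensor (generic_pfister K 1) (qbase (ratfun_const K 1) psi)) ->
  iso_equiv phi psi.
Proof.
have -> : generic_pfister K 1 = pfister [:: ratfun_var K (0 : 'I_1)].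
  rewrite /generic_pfister (_ : enum 'I_1 = [:: 0]) //.
  by apply: (inj_map val_inj); rewrite val_enum_ord.
move=> eqv F f; have [g [gc gv]] := ratfun_extend f 1; have := eqv _ g.
have tensE (q : qform K) : qisotropic (qbase g (qtensor
    (pfister [:: ratfun_var K (0 : 'I_1)]) (qbase (ratfun_const K 1) q))) <->
    qisotropic (qbase f q).
  rewrite -[X in X <-> _]/(mxiso (map_mx g (qmx (qdiag [:: 1; - ratfun_var K 0]) *t
    qmx (qdiag [:: 1]) *t map_mx (ratfun_const K 1) (qmx q)))) 2!map_mxT.
  rewrite map_qdiag gv -map_mx_comp.
  have -> : map_mx (g \o ratfun_const K 1) (qmx q) =
      map_mx (ratfun_const F 1) (map_mx f (qmx q)).
    by apply/matrixP => i j; rewrite !mxE /= gc.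
  have -> : map_mx g (qmx (qdiag [:: 1])) = qmx (qdiag [:: 1]).
    by apply/matrixP => i j; rewrite !mxE !ord1 /= rmorphMn rmorph1.
  (* The factor <1> closing the Pfister product can be cancelled only on the far left, so it is
     commuted there first. *)
  rewrite -(generic_tens_iso (qbase f q)) mxiso_tensA mxiso_tensC mxiso_tensA mxiso_tens1.
  exact: mxiso_tensC.
by rewrite !tensE.
Qed.

Lemma generic_pfister_vars_neq0 (K : fieldType) n :
  all (fun a => a != 0) [seq ratfun_var K i | i <- enum 'I_n].
Proof.
apply/allP => _ /mapP[i _ ->].
by rewrite tofrac_eq0 -mleadc_eq0 mleadXm mcoeffX eqxx oner_eq0.
Qed.

Lemma iso_equiv_represents (K F : fieldType) (f : {rmorphism K -> F})
    (phi psi : qform K) (c : F) : 2%:R != 0 :> K ->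
  qnondegenerate phi -> qnondegenerate psi ->
  (0 < qdim phi)%N -> (0 < qdim psi)%N -> iso_equiv phi psi ->
  qrepresents_mul (qbase f psi) c <-> qrepresents_mul (qbase f phi) c.
Proof.
move=> two np nq dp dq eqv; have twoF := rmorph2_neq0 f two.
rewrite !represents_mulP ?qbase_nondegenerate //.
by split=> -[c0 h]; split=> //; apply/(iso_equiv_binary_tens f two _ _ eqv c0).
Qed.

(** Test the represented products over F(t) on the single element t. *)
Lemma represents_iso_equiv (K : fieldType) (phi psi : qform K) : 2%:R != 0 :> K ->
  qnondegenerate phi -> qnondegenerate psi ->
  (forall (F : fieldType) (f : {rmorphism K -> F}) (c : F),
    qrepresents_mul (qbase f psi) c <-> qrepresents_mul (qbase f phi) c) ->
  iso_equiv phi psi.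
Proof.
move=> two np nq rep F f.
have t0 : ratfun_var F (0 : 'I_1) != 0.
  by rewrite tofrac_eq0 -mleadc_eq0 mleadXm mcoeffX eqxx oner_eq0.
pose j : {rmorphism K -> ratfun F 1} := ratfun_const F 1 \o f.
have E (q : qform K) : qnondegenerate q ->
    qrepresents_mul (qbase j q) (ratfun_var F 0) <-> qisotropic (qbase f q).
  move=> nd; have P := represents_mulP (ratfun_var F (0 : 'I_1))
    (rmorph2_neq0 j two) (qbase_nondegenerate j nd).
  rewrite -(generic_tens_iso (qbase f q)) -map_mx_comp.
  by split=> [/P[]|h]; last exact/P.
by rewrite -!E // rep.
Qed.

Lemma iso_equiv_general_pfister (K : fieldType) (phi psi tau : qform K) n :
  2%:R != 0 :> K -> (0 < qdim phi)%N -> (0 < qdim psi)%N ->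
  iso_equiv phi psi -> general_pfister n tau ->
  iso_equiv (qtensor phi tau) (qtensor psi tau).
Proof.
move=> two dp dq eqv [c [s [c0 _ s0 iso]]].
have E (q : qform K) : iso_equiv (qtensor q tau) (qtensor (pfister s) q).
  apply: iso_equiv_trans (iso_equiv_tensC _ _) _.
  apply: iso_equiv_trans (iso_equiv_isometric (isometric_tens q iso)) _.
  exact: iso_equiv_scale.
apply: iso_equiv_trans (E phi) _; apply: iso_equiv_trans (iso_equiv_sym (E psi)).
exact: iso_equiv_pfister.
Qed.

Lemma general_pfister_nondegenerate (K : fieldType) n (tau : qform K) :
  general_pfister n tau -> qnondegenerate tau /\ (0 < qdim tau)%N.
Proof.
move=> [c [s [c0 _ s0 iso]]]; split; last by rewrite (isometric_qdim iso) qdim_pfister_gt0.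
rewrite (isometric_nondegenerate iso) /qnondegenerate /= -mul_scalar_mx unitmx_mul.
rewrite unitmxE det_scalar unitrX ?unitfE //; exact: pfister_nondegenerate.
Qed.

Lemma generic_pfister_general (K : fieldType) n :
  general_pfister n (generic_pfister K n).
Proof.
exists 1, [seq ratfun_var K i | i <- enum 'I_n]; rewrite oner_eq0; split=> //.
- by rewrite size_map size_enum_ord.
- exact: generic_pfister_vars_neq0.
exists 1%:M; rewrite row_free_unit row_full_unit unitmx1; split=> //=.
by rewrite scale1r trmx1 mulmx1 mul1mx.
Qed.

Local Close Scope ring_scope.

Theorem theorem4p5 (K : fieldType) (phi psi : qform K)
  (charK : 2%N \notin [pchar K]%R)
  (nd_phi : qnondegenerate phi) (nd_psi : qnondegenerate psi)
  (an_phi : qanisotropic phi) (an_psi : qanisotropic psi)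
  (dim_phi : 2 <= qdim phi) (dim_psi : 2 <= qdim psi) :
  [<-> stb phi psi;
       forall (F : fieldType) (f : {rmorphism K -> F}) (c : F),
         qrepresents_mul (qbase f psi) c <-> qrepresents_mul (qbase f phi) c;
       forall n : nat, 1 <= n ->
         stb (qtensor (generic_pfister K n) (qbase (ratfun_const K n) phi))
             (qtensor (generic_pfister K n) (qbase (ratfun_const K n) psi));
       forall (F : fieldType) (f : {rmorphism K -> F}) (n : nat), 1 <= n ->
       forall tau : qform F, general_pfister n tau ->
         stb (qtensor (qbase f phi) tau) (qtensor (qbase f psi) tau)].
Proof.
have two := natr2_neq0 charK.
have [dp0 dq0] : 0 < qdim phi /\ 0 < qdim psi by split; apply: ltnW.
have stbE := stbP two nd_phi nd_psi dim_phi dim_psi.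
(* Both orders of the factors are covered: condition (3) has the Pfister form on the left, condition
   (4) on the right. *)
have tensP (F : fieldType) (f : {rmorphism K -> F}) n (tau : qform F) :
    general_pfister n tau ->
    (stb (qtensor (qbase f phi) tau) (qtensor (qbase f psi) tau) <->
     iso_equiv (qtensor (qbase f phi) tau) (qtensor (qbase f psi) tau)) /\
    (stb (qtensor tau (qbase f phi)) (qtensor tau (qbase f psi)) <->
     iso_equiv (qtensor tau (qbase f phi)) (qtensor tau (qbase f psi))).
  move=> /general_pfister_nondegenerate[ndt dt].
  have twoF := rmorph2_neq0 f two.
  have gt1 a b : 1 < a -> 0 < b -> 1 < a * b.
    by move=> a1 b0; apply: leq_trans a1 _; apply: leq_pmulr.
  split; apply: stbP => //=; rewrite ?[qdim tau * _]mulnC; try exact: gt1;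
    by apply: qtensor_nondegenerate => //; apply: qbase_nondegenerate.
tfae.
- by move/stbE => eqv F f c; apply: iso_equiv_represents.
- move=> /(represents_iso_equiv two nd_phi nd_psi) eqv n _.
  apply/(tensP _ _ _ _ (generic_pfister_general K n)).2.
  apply: iso_equiv_pfister => //; last exact: generic_pfister_vars_neq0.
    exact: rmorph2_neq0 (ratfun_const K n) two.
  exact: iso_equiv_base.
- move=> /(_ 1%N isT) /(tensP _ _ _ _ (generic_pfister_general K 1)).2.
  move=> /generic_pfister_iso_equiv eqv F f n _ tau gt; apply/(tensP _ _ _ _ gt).1.
  apply: iso_equiv_general_pfister gt => //; first exact: rmorph2_neq0 f two.
  exact: iso_equiv_base.
(* Condition (4) is applied over K(t) to <<t>>, with the factors swapped afterwards. *)
- move=> /(_ _ (ratfun_const K 1) 1%N isT _ (generic_pfister_general K 1)).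
  move=> /(tensP _ _ _ _ (generic_pfister_general K 1)).1 eqv; apply/stbE.
  apply: generic_pfister_iso_equiv.
  apply: iso_equiv_trans (iso_equiv_tensC _ _) _.
  exact: iso_equiv_trans eqv (iso_equiv_tensC _ _).
Qed.
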